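(* Let $\mathcal{H}_X$ and $\mathcal{H}_Y$ be finite-dimensional Hilbert spaces of two systems $X$ and $Y$. Let $P$ be a family of reference sets assigning to each of the Hilbert spaces $\mathcal{H}_X\otimes\mathcal{H}_Y$, $\mathcal{H}_X$, $\mathcal{H}_Y$ a convex set of states ($P(\mathcal{H}_X\otimes\mathcal{H}_Y)\subset\mathcal{D}(\mathcal{H}_X\otimes\mathcal{H}_Y)$, etc.; we write $\sigma\in P$ when $\sigma$ belongs to the set for its own space). Let $\mathbb{M}$ be a class of measurement operations on $X$. Assume: (1) for every measurement in $\mathbb{M}$ with POVM elements $(M_i)_i$, every $i$, and every $\sigma_{XY}\in P$ with ${\rm Tr}((M_i\otimes\mathbb{1}_Y)\sigma_{XY})>0$, the normalized conditional state ${\rm Tr}_X((M_i\otimes\mathbb{1}_Y)\sigma_{XY})/{\rm Tr}((M_i\otimes\mathbb{1}_Y)\sigma_{XY})$ belongs to $P$; (2) $P$ is closed under partial trace, so that in particular $\sigma_{XY}\in P$ implies $\sigma_X={\rm Tr}_Y\sigma_{XY}\in P$. Then for every state $\rho_{XY}\in\mathcal{D}(\mathcal{H}_X\otimes\mathcal{H}_Y)$, \[ E^P_R(\rho_{XY})\geq \mathbb{M}E^P_R(\rho_X)+E^P_R(\rho_Y), \] where $\rho_X={\rm Tr}_Y(\rho_{XY})$ and $\rho_Y={\rm Tr}_X(\rho_{XY})$.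
   Context: $\mathcal{D}(\mathcal{H})$ denotes the set of density operators (positive, trace one) on $\mathcal{H}$. The quantum relative entropy is $S(\rho\|\sigma)={\rm Tr}\rho\log\rho-{\rm Tr}\rho\log\sigma$ (equal to $+\infty$ if the support of $\rho$ is not contained in that of $\sigma$); for probability distributions $S((p_i)_i\|(q_i)_i)=\sum_i p_i\log(p_i/q_i)$ (infinite if some $p_i>0$ with $q_i=0$). A measurement operation $\mathcal{M}$ associated with a POVM $(M_i)_i$ ($M_i\geq0$, $\sum_iM_i=\mathbb{1}$) is the map $\mathcal{M}(Z)=\sum_i{\rm Tr}(M_iZ)|i\rangle\langle i|$ for an orthonormal set $\{|i\rangle\}$. For a class $\mathbb{M}$ of measurement operations, $\mathbb{M}S(\rho\|\sigma)=\sup_{\mathcal{M}\in\mathbb{M}}S(\mathcal{M}(\rho)\|\mathcal{M}(\sigma))$. For a reference set $P$ of states on $\mathcal{H}$, $E^P_R(\rho)=\inf_{\sigma\in P}S(\rho\|\sigma)$ and $\mathbb{M}E^P_R(\rho)=\inf_{\sigma\in P}\mathbb{M}S(\rho\|\sigma)$. *)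

(* Defs.v *)
From HB Require Import structures.
From mathcomp Require Import all_boot all_order all_algebra.
From mathcomp Require Import sesquilinear spectral.
From mathcomp Require Import complex mxtens.
From mathcomp Require Import classical_sets reals constructive_ereal ereal exp.

Set Implicit Arguments.
Unset Strict Implicit.
Unset Printing Implicit Defensive.

Import Order.TTheory GRing.Theory Num.Theory.
Local Open Scope ring_scope.
Local Open Scope classical_set_scope.

Definition adjmx (R : realType) m n (A : 'M[R[i]]_(m, n)) : 'M[R[i]]_(n, m) :=
  map_mx Num.conj (trmx A).

Definition psdmx (R : realType) n (A : 'M[R[i]]_n) : Prop :=
  forall v : 'rV[R[i]]_n, 0 <= (v *m A *m adjmx v) 0 0.

Definition density (R : realType) n (A : 'M[R[i]]_n) : Prop :=
  psdmx A /\ \tr A = 1.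

(* Functional calculus through the spectral decomposition
   A = U^-1 diag(d) U (U unitary) of mathcomp's spectral.v:
   f(A) = U^-1 diag(f (Re d)) U. *)
Definition mxfun (R : realType) (f : R -> R) n (A : 'M[R[i]]_n) : 'M[R[i]]_n :=
  invmx (spectralmx A) *m
  diag_mx (\row_j (f (complex.Re (spectral_diag A 0 j)))%:C%C) *m
  spectralmx A.

Definition mxlog (R : realType) n (A : 'M[R[i]]_n) := mxfun (@ln R) A.

(* Quantum relative entropy S(rho||sigma) = Tr rho log rho - Tr rho log sigma,
   +oo unless supp rho is contained in supp sigma (for psd matrices the support
   condition is inclusion of row spaces). *)
Definition qrelent (R : realType) n (rho sigma : 'M[R[i]]_n) : \bar R :=
  if (rho <= sigma)%MS then
    (complex.Re (\tr (rho *m mxlog rho) - \tr (rho *m mxlog sigma)))%:E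
  else +oo%E.

(* Classical relative entropy of finite distributions (with 0 log 0 = 0). *)
Definition crelent (R : realType) k (p q : 'I_k -> R) : \bar R :=
  if [forall i, (0 < p i) ==> (0 < q i)] then
    (\sum_(i < k | 0 < p i) p i * ln (p i / q i))%:E
  else +oo%E.

Record meas (R : realType) (n : nat) := Meas {
  meas_card : nat;
  meas_op : 'I_meas_card -> 'M[R[i]]_n }.
Arguments meas_card {R n} m.
Arguments meas_op {R n} m _.

Definition is_povm (R : realType) n (M : meas R n) : Prop :=
  (forall i, psdmx (meas_op M i)) /\ \sum_(i < meas_card M) meas_op M i = 1%:M.

Definition meas_prob (R : realType) n (M : meas R n) (Z : 'M[R[i]]_n) :
  'I_(meas_card M) -> R :=
  fun i => complex.Re (\tr (meas_op M i *m Z)).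
Arguments meas_prob {R n} M Z _.

Definition measured_relent (R : realType) n (MM : set (meas R n))
  (rho sigma : 'M[R[i]]_n) : \bar R :=
  ereal_sup [set crelent (meas_prob M rho) (meas_prob M sigma) | M in MM].

Definition ER (R : realType) n (P : set 'M[R[i]]_n) (rho : 'M[R[i]]_n) : \bar R :=
  ereal_inf [set qrelent rho sigma | sigma in P].

Definition MER (R : realType) n (MM : set (meas R n)) (P : set 'M[R[i]]_n)
  (rho : 'M[R[i]]_n) : \bar R :=
  ereal_inf [set measured_relent MM rho sigma | sigma in P].

(* Partial traces on H_X (x) H_Y = C^(n*m), index (i,k) |-> i*m + k. *)
Definition ptraceY (R : realType) n m (A : 'M[R[i]]_(n * m)) : 'M[R[i]]_n :=
  \matrix_(i, j) \sum_(k < m) A (mxtens_index (i, k)) (mxtens_index (j, k)).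

Definition ptraceX (R : realType) n m (A : 'M[R[i]]_(n * m)) : 'M[R[i]]_m :=
  \matrix_(k, l) \sum_(i < n) A (mxtens_index (i, k)) (mxtens_index (i, l)).

Definition convex_states (R : realType) n (P : set 'M[R[i]]_n) : Prop :=
  (forall s, P s -> density s) /\
  (forall s t (l : R), P s -> P t -> 0 <= l <= 1 ->
     P (l%:C%C *: s + (1 - l)%:C%C *: t)).

(* Main.v *)
(** Superadditivity follows from two applications of the monotonicity of the
    relative entropy.  Write [rho^i] for the unnormalized state of [Y] after
    outcome [i], [p_i = Tr rho^i], [q_i = Tr sigma^i], and
    [tau = sum_i (p_i / q_i) sigma^i], which lies in [P] by convexity.  Then
    S(rho||sigma) >= sum_i S(rho^i||sigma^i)
                   = S(p||q) + sum_i S(rho^i||(p_i/q_i) sigma^i)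
                  >= S(p||q) + S(rho_Y||tau).

    Monotonicity is obtained from a variational formula.  With eigenvalues
    [a_j], [b_k] of [rho], [sigma] and squared eigenvector overlaps [c_jk],
    for [0 < s < 1]
    [sum_jk c_jk a_j^2 / ((1-s) b_k + s a_j)
       = max_K 2 Re Tr(K rho) - (1-s) Tr(K sigma K^* ) - s Tr(K^* rho K)].
    The right-hand side is monotone: an operator [K_i] for each outcome is pulled
    back to [sum_i M_i (x) K_i], and Kadison-Schwarz controls the quadratic terms.
    The left-hand side is, up to a constant and the factor [1-s], the derivative
    of [s |-> sum_jk c_jk a_j ln ((1-s) b_k + s a_j)], whose increment over
    [[0,1]] is the relative entropy. *)

Require Import Defs.
From HB Require Import structures.
From mathcomp Require Import all_boot all_order all_algebra.
From mathcomp Require Import sesquilinear spectral.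
From mathcomp Require Import complex mxtens.
From mathcomp Require Import classical_sets reals constructive_ereal ereal exp.
From mathcomp Require Import boolp functions normedtype derive realfun.
From mathcomp Require Import ring lra.
Set Implicit Arguments.
Unset Strict Implicit.
Unset Printing Implicit Defensive.
Import Order.TTheory GRing.Theory Num.Theory.
Import numFieldNormedType.Exports.
Local Open Scope ring_scope.
Local Open Scope classical_set_scope.

(** * A logarithmic inequality from its derivative *)

Lemma is_derive_bigsum (R : realType) (I : Type) (r : seq I) (P : pred I)
    (h : I -> R -> R) (dh : I -> R) (x : R) :
  (forall i, P i -> is_derive x 1 (h i) (dh i)) ->
  is_derive x 1 (fun t => \sum_(i <- r | P i) h i t) (\sum_(i <- r | P i) dh i).
Proof.
move=> hd; elim: r => [|i r ih].
  rewrite big_nil (_ : (fun=> _) = (fun=> 0 : R)).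
    exact: is_derive_cst.
  by apply/boolp.funext => t; rewrite big_nil.
rewrite big_cons; case: ifP => Pi; last first.
  by under boolp.eq_fun => t do rewrite big_cons Pi.
rewrite (_ : (fun=> _) = h i + (fun t => \sum_(j <- r | P j) h j t)).
  by have hi := hd i Pi; exact: is_deriveD.
by apply/boolp.funext => t; rewrite big_cons Pi.
Qed.

Lemma convex_comb_gt0 (R : realFieldType) (a b s : R) :
  0 < a -> 0 < b -> 0 <= s <= 1 -> 0 < (1 - s) * b + s * a.
Proof. by move=> a0 b0 /andP[s0 s1]; nra. Qed.

Lemma is_derive_ln_segment (R : realType) (a b s : R) :
  0 < a -> 0 < b -> 0 <= s <= 1 ->
  is_derive s 1 (fun t => ln ((1 - t) * b + t * a))
    ((a - b) / ((1 - s) * b + s * a)).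
Proof.
move=> a0 b0 s01; have d0 := convex_comb_gt0 a0 b0 s01.
rewrite mulrC; apply: (@is_derive1_comp _ (@ln R)
  (fun t => (1 - t) * b + t * a) s).
  exact: is_derive1_ln.
rewrite (_ : (fun=> _) = (b \*: (fun t : R => 1 - t) + a \*: (fun t : R => t))).
  apply: is_derive_eq; rewrite /GRing.scale /=; ring.
by apply/boolp.funext => t; rewrite /GRing.scale /= /GRing.add /= /GRing.scale /=;
   congr (_ + _); rewrite mulrC.
Qed.

(* Differentiate h(s) = sum_i w_i ln ((1 - s) b_i + s a_i): since the weights
   sum to 0, the hypothesis says exactly that (1 - s) h'(s) >= 0. *)
Lemma sum_ln_ratio_ge0 (R : realType) (I : finType) (w a b : I -> R) :
  (forall i, w i != 0 -> 0 < a i) -> (forall i, w i != 0 -> 0 < b i) ->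
  \sum_i w i = 0 ->
  (forall s, 0 < s < 1 ->
     0 <= \sum_i w i * (a i / ((1 - s) * b i + s * a i))) ->
  0 <= \sum_i w i * (ln (a i) - ln (b i)).
Proof.
move=> a0 b0 w0 hs.
have restr (F : I -> R) :
    \sum_i w i * F i = \sum_(i | w i != 0) w i * F i.
  rewrite [LHS](bigID (fun i => w i != 0)) /= [X in _ + X]big1 ?addr0 //.
  by move=> i; rewrite negbK => /eqP ->; rewrite mul0r.
pose h (t : R) := \sum_(i | w i != 0) w i * ln ((1 - t) * b i + t * a i).
pose dh (t : R) :=
  \sum_(i | w i != 0) w i * ((a i - b i) / ((1 - t) * b i + t * a i)).
have hder (t : R) : 0 <= t <= 1 -> is_derive t 1 h (dh t).
  move=> t01; apply: is_derive_bigsum => i wi.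
  by apply: is_deriveZ; apply: is_derive_ln_segment t01; [exact: a0|exact: b0].
have [|| c] := @MVT R h dh 0 1 ltr01.
- by move=> x; rewrite in_itv /= => /andP[x0 x1]; apply: hder; rewrite !ltW.
- by apply: derivable_within_continuous => x; rewrite in_itv /= => x01;
    have [] := hder _ x01.
rewrite in_itv /= => c01; rewrite subr0 mulr1 => hE.
have -> : \sum_i w i * (ln (a i) - ln (b i)) = h 1 - h 0.
  rewrite restr /h -sumrB; apply: eq_bigr => i _.
  by rewrite -mulrBr !(subrr, subr0, mul0r, mul1r, add0r, addr0).
have /andP[c0 c1] := c01.
rewrite hE -(pmulr_rge0 _ (_ : 0 < 1 - c)) ?subr_gt0 //.
rewrite (_ : (1 - c) * dh c =
   \sum_i w i * (a i / ((1 - c) * b i + c * a i)) - \sum_i w i).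
  by rewrite w0 subr0 hs.
rewrite -[\sum_i w i](eq_bigr _ (fun i _ => mulr1 (w i))) !restr -sumrB /dh mulr_sumr.
apply: eq_bigr => i wi.
have d0 : 0 < (1 - c) * b i + c * a i.
  by apply: convex_comb_gt0; rewrite ?a0 ?b0 // !ltW.
field; exact: lt0r_neq0.
Qed.

(** The two families are merged over [I + J] with [w'] negated: equal total weights become total
    weight zero, and [sum_ln_ratio_ge0] applies. *)
Lemma le_sum_ln_ratio (R : realType) (I J : finType)
    (w a b : I -> R) (w' a' b' : J -> R) :
  (forall i, w i != 0 -> 0 < a i) -> (forall i, w i != 0 -> 0 < b i) ->
  (forall j, w' j != 0 -> 0 < a' j) -> (forall j, w' j != 0 -> 0 < b' j) ->
  \sum_i w i = \sum_j w' j ->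
  (forall s, 0 < s < 1 ->
     \sum_j w' j * (a' j / ((1 - s) * b' j + s * a' j)) <=
     \sum_i w i * (a i / ((1 - s) * b i + s * a i))) ->
  \sum_j w' j * (ln (a' j) - ln (b' j)) <= \sum_i w i * (ln (a i) - ln (b i)).
Proof.
move=> a0 b0 a0' b0' ww hs.
pose W (k : I + J) := match k with inl i => w i | inr j => - w' j end.
pose A (k : I + J) := match k with inl i => a i | inr j => a' j end.
pose B (k : I + J) := match k with inl i => b i | inr j => b' j end.
have sumW (F : I + J -> R) :
    \sum_k W k * F k = \sum_i w i * F (inl i) - \sum_j w' j * F (inr j).
  rewrite big_sumType /= -sumrN; congr (_ + _).
  by apply: eq_bigr => j _; rewrite mulNr.
have := @sum_ln_ratio_ge0 R _ W A B; rewrite sumW subr_ge0; apply.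
- by case=> [i|j] /=; rewrite ?oppr_eq0 => ?; [exact: a0|exact: a0'].
- by case=> [i|j] /=; rewrite ?oppr_eq0 => ?; [exact: b0|exact: b0'].
- by rewrite big_sumType /= sumrN ww subrr.
- by move=> s s01; rewrite sumW subr_ge0 hs.
Qed.

(** * Positive semidefinite complex matrices *)

Section MatrixBasics.
Variable R : realType.
Local Notation C := R[i].
Local Notation Re := (@complex.Re R).
Local Notation Im := (@complex.Im R).

Lemma ReD (x y : C) : Re (x + y) = Re x + Re y.
Proof. by case: x; case: y. Qed.

Lemma ReB (x y : C) : Re (x - y) = Re x - Re y.
Proof. by case: x; case: y. Qed.

Lemma Re_sum (I : Type) (r : seq I) (P : pred I) (F : I -> C) :
  Re (\sum_(i <- r | P i) F i) = \sum_(i <- r | P i) Re (F i).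
Proof. by apply: (big_morph Re ReD). Qed.

Lemma ReZ (x : R) (z : C) : Re (x%:C%C * z) = x * Re z.
Proof. by case: z => u v /=; rewrite mul0r subr0. Qed.

Lemma conjE (z : C) : Num.conj z = (complex.Re z -i* complex.Im z)%C.
Proof. by case: z. Qed.

Definition sqnorm (z : C) : R := Re z ^+ 2 + Im z ^+ 2.

Lemma sqnorm_ge0 z : 0 <= sqnorm z.
Proof. by rewrite addr_ge0 ?sqr_ge0. Qed.

Lemma sqnormE (z : C) : z * Num.conj z = (sqnorm z)%:C%C.
Proof.
case: z => u v; rewrite conjE /sqnorm /=.
by apply/eqP; rewrite eq_complex /=; apply/andP; split; apply/eqP; ring.
Qed.

Lemma sqnorm_conj (z : C) : sqnorm (Num.conj z) = sqnorm z.
Proof. by case: z => u v; rewrite conjE /sqnorm /=; ring. Qed.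

Lemma ge0_Re (z : C) : 0 <= z -> (Re z)%:C%C = z /\ 0 <= Re z.
Proof. by case: z => u v; rewrite lecE /= => /andP[/eqP -> ->]. Qed.

Lemma adjmxE m n (A : 'M[C]_(m, n)) i j : adjmx A i j = Num.conj (A j i).
Proof. by rewrite !mxE. Qed.

Lemma adjmxK m n (A : 'M[C]_(m, n)) : adjmx (adjmx A) = A.
Proof. exact: trmxCK. Qed.

Lemma adjmxD m n (A B : 'M[C]_(m, n)) : adjmx (A + B) = adjmx A + adjmx B.
Proof. by apply/matrixP => i j; rewrite !mxE rmorphD. Qed.

Lemma adjmxB m n (A B : 'M[C]_(m, n)) : adjmx (A - B) = adjmx A - adjmx B.
Proof. by apply/matrixP => i j; rewrite !mxE rmorphB. Qed.

Lemma adjmxM m n p (A : 'M[C]_(m, n)) (B : 'M[C]_(n, p)) :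
  adjmx (A *m B) = adjmx B *m adjmx A.
Proof. by rewrite /adjmx trmx_mul map_mxM. Qed.

Lemma adjmxZ m n (c : C) (A : 'M[C]_(m, n)) :
  adjmx (c *: A) = Num.conj c *: adjmx A.
Proof. by apply/matrixP => i j; rewrite !mxE rmorphM. Qed.

Lemma adjmx_sum m n (I : Type) (r : seq I) (P : pred I) (F : I -> 'M[C]_(m, n)) :
  adjmx (\sum_(i <- r | P i) F i) = \sum_(i <- r | P i) adjmx (F i).
Proof.
apply: (big_morph (@adjmx R m n)); first exact: adjmxD.
by apply/matrixP => i j; rewrite !mxE rmorph0.
Qed.

Lemma adjmx1 n : adjmx (1%:M : 'M[C]_n) = 1%:M.
Proof. by apply/matrixP => i j; rewrite !mxE eq_sym rmorph_nat. Qed.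

Lemma adjmx_tens m n p q (A : 'M[C]_(m, n)) (B : 'M[C]_(p, q)) :
  adjmx (A *t B) = adjmx A *t adjmx B.
Proof. by rewrite /adjmx trmx_tens map_mxT. Qed.

Lemma adjmx_diag n (d : 'I_n -> R) :
  adjmx (diag_mx (\row_j (d j)%:C%C)) = diag_mx (\row_j (d j)%:C%C) :> 'M[C]_n.
Proof.
apply/matrixP => i j; rewrite !mxE rmorphMn /= conjE /= oppr0 eq_sym.
by case: eqP => [->|_]; rewrite ?mulr0n.
Qed.

Lemma quad_mulmx m n (A : 'M[C]_n) (N : 'M[C]_(m, n)) i :
  (N *m A *m adjmx N) i i = (row i N *m A *m adjmx (row i N)) 0 0.
Proof. by rewrite -row_mul !mxE; apply: eq_bigr => k _; rewrite !mxE. Qed.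

Lemma tr_quad m n (A : 'M[C]_n) (N : 'M[C]_(m, n)) :
  \tr (N *m A *m adjmx N) = \sum_i (row i N *m A *m adjmx (row i N)) 0 0.
Proof. rewrite /mxtrace; apply: eq_bigr => i _; exact: quad_mulmx. Qed.

Lemma tr_quad_ge0 m n (A : 'M[C]_n) (N : 'M[C]_(m, n)) :
  psdmx A -> 0 <= \tr (N *m A *m adjmx N).
Proof. by move=> pA; rewrite tr_quad sumr_ge0. Qed.

(* Polarization: a complex form that is real on the diagonal is hermitian. *)
Lemma psdmx_herm n (A : 'M[C]_n) : psdmx A -> adjmx A = A.
Proof.
move=> pA; apply/matrixP => i j; rewrite adjmxE.
pose e (k : 'I_n) : 'rV[C]_n := delta_mx 0 k.
have eE k l : (e k *m A *m adjmx (e l)) 0 0 = A k l.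
  rewrite -rowE !mxE (bigD1 l) //= !mxE !eqxx rmorph_nat mulr1 big1 ?addr0 //.
  by move=> t tl; rewrite !mxE (negPf tl) andbF rmorph0 mulr0.
have quad (c : C) : 0 <= A i i + c * A j i + Num.conj c * A i j
    + c * Num.conj c * A j j.
  suff <- : ((e i + c *: e j) *m A *m adjmx (e i + c *: e j)) 0 0 =
    A i i + c * A j i + Num.conj c * A i j + c * Num.conj c * A j j by [].
  rewrite adjmxD adjmxZ !mulmxDl !mulmxDr -!scalemxAl -!scalemxAr.
  have DE (X Y : 'M[C]_1) : (X + Y) 0 0 = X 0 0 + Y 0 0 by rewrite mxE.
  have ZE (x : C) (X : 'M[C]_1) : (x *: X) 0 0 = x * X 0 0 by rewrite mxE.
  by rewrite !(DE, ZE) !eE; ring.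
have dg k : 0 <= A k k by rewrite -eE.
(* Taking 1 for [c] makes the imaginary parts of [A i j] and [A j i] opposite; the imaginary unit
   makes their real parts equal. *)
have := quad 1; have := quad 'i%C; have := dg i; have := dg j.
case: (A i i) => aii bii; case: (A j j) => ajj bjj.
case: (A i j) => aij bij; case: (A j i) => aji bji.
rewrite !conjE !lecE /= => /andP[/eqP h1 _] /andP[/eqP h2 _].
move=> /andP[/eqP h3 _] /andP[/eqP h4 _].
apply/eqP; rewrite eq_complex /=; apply/andP; split; apply/eqP; lra.
Qed.

(** * Spectral decomposition and Gram factors *)

Definition diagonalizes n (U : 'M[C]_n) (a : 'I_n -> R) (A : 'M[C]_n) :=
  [/\ U *m adjmx U = 1%:M, (forall j, 0 <= a j) &
      A = adjmx U *m diag_mx (\row_j (a j)%:C%C) *m U].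

Definition evals n (A : 'M[C]_n) (j : 'I_n) : R := Re (spectral_diag A 0 j).

Lemma diagonalizesV n (U : 'M[C]_n) a A :
  diagonalizes U a A -> adjmx U *m U = 1%:M.
Proof. by case=> /mulmx1C. Qed.

Lemma diagonalizesK n (U : 'M[C]_n) a A :
  diagonalizes U a A -> U *m A *m adjmx U = diag_mx (\row_j (a j)%:C%C).
Proof. by case=> UU _ ->; rewrite !mulmxA UU mul1mx -mulmxA UU mulmx1. Qed.

Lemma psdmx_diagonalizes n (A : 'M[C]_n) :
  psdmx A -> diagonalizes (spectralmx A) (evals A) A.
Proof.
move=> pA; have hA := psdmx_herm pA.
have nA : A \is normalmx.
  apply: hermitian_normalmx; apply/is_hermitianmxP.
  by rewrite expr0 scale1r -[RHS]/(adjmx A) hA.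
have uU := spectral_unitarymx A.
have UU : spectralmx A *m adjmx (spectralmx A) = 1%:M by apply/eqP; exact: uU.
have AE := orthomx_spectralP nA.
rewrite invmx_unitary // -/(adjmx _) in AE.
have dge j : 0 <= spectral_diag A 0 j.
  have -> : spectral_diag A 0 j =
      (spectralmx A *m A *m adjmx (spectralmx A)) j j.
    rewrite {3}AE !mulmxA UU mul1mx -mulmxA UU mulmx1.
    by rewrite mxE eqxx mulr1n.
  by rewrite quad_mulmx.
split=> // [j|]; first by have [] := ge0_Re (dge j).
rewrite {1}AE; congr (_ *m diag_mx _ *m _); apply/rowP => j.
by rewrite !mxE; have [] := ge0_Re (dge j).
Qed.

Lemma psdmx_gram n (A : 'M[C]_n) : psdmx A -> exists B : 'M[C]_n, A = adjmx B *m B.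
Proof.
move=> /psdmx_diagonalizes[UU a0 ->].
exists (diag_mx (\row_j (Num.sqrt (evals A j))%:C%C) *m spectralmx A).
rewrite adjmxM adjmx_diag !mulmxA; congr (_ *m _); rewrite -mulmxA; congr (_ *m _).
rewrite mulmx_diag; congr diag_mx; apply/rowP => j; rewrite !mxE.
by rewrite -rmorphM /= -expr2 sqr_sqrtr.
Qed.

Lemma gram_psdmx m n (B : 'M[C]_(m, n)) : psdmx (adjmx B *m B).
Proof.
move=> v; have -> : v *m (adjmx B *m B) *m adjmx v =
    (v *m adjmx B) *m adjmx (v *m adjmx B).
  by rewrite adjmxM adjmxK !mulmxA.
rewrite mxE sumr_ge0 // => i _; rewrite adjmxE sqnormE ler0c; exact: sqnorm_ge0.
Qed.

Lemma tr_psdmx_mul_ge0 n (A B : 'M[C]_n) : psdmx A -> psdmx B -> 0 <= \tr (A *m B).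
Proof.
move=> /psdmx_gram[N ->] pB.
by rewrite -mulmxA mxtrace_mulC tr_quad_ge0.
Qed.

Lemma psdmx_quad m n (N : 'M[C]_(m, n)) (A : 'M[C]_n) :
  psdmx A -> psdmx (N *m A *m adjmx N).
Proof.
move=> /psdmx_gram[B ->].
have -> : N *m (adjmx B *m B) *m adjmx N = adjmx (B *m adjmx N) *m (B *m adjmx N).
  by rewrite adjmxM adjmxK !mulmxA.
exact: gram_psdmx.
Qed.

Lemma psdmx_sum n (I : Type) (r : seq I) (P : pred I) (F : I -> 'M[C]_n) :
  (forall i, P i -> psdmx (F i)) -> psdmx (\sum_(i <- r | P i) F i).
Proof.
move=> pF v; rewrite mulmx_sumr mulmx_suml summxE sumr_ge0 // => i Pi.
exact: pF.
Qed.

Lemma psdmxZ n (c : R) (A : 'M[C]_n) : 0 <= c -> psdmx A -> psdmx (c%:C%C *: A).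
Proof.
by move=> c0 pA v; rewrite -scalemxAr -scalemxAl mxE mulr_ge0 ?ler0c.
Qed.

End MatrixBasics.

(** * Variational formula *)

Section Variational.
Variable R : realType.
Local Notation C := R[i].
Local Notation Re := (@complex.Re R).
Local Notation cdiag d := (diag_mx (\row_j (d j)%:C%C)).

Lemma tr_cdiag_sandwich m n (x : 'I_m -> R) (y : 'I_n -> R) (G : 'M[C]_(m, n)) :
  \tr (cdiag x *m G *m cdiag y *m adjmx G) =
  (\sum_j \sum_k x j * y k * sqnorm (G j k))%:C%C.
Proof.
rewrite rmorph_sum /mxtrace; apply: eq_bigr => j _.
rewrite rmorph_sum mxE; apply: eq_bigr => k _.
rewrite mul_mx_diag mul_diag_mx adjmxE !mxE !rmorphM /= -sqnormE.
by rewrite -!mulrA; congr (_ * _); rewrite mulrCA.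
Qed.

(** The coefficient [c_jk] of the overview: the squared modulus of the inner product of row [k] of
    [V] with row [j] of [U]. *)
Definition overlap n (U V : 'M[C]_n) (j k : 'I_n) : R :=
  sqnorm ((V *m adjmx U) k j).

Lemma overlap_ge0 n (U V : 'M[C]_n) j k : 0 <= overlap U V j k.
Proof. exact: sqnorm_ge0. Qed.

Lemma overlapE n (U V : 'M[C]_n) j k :
  overlap U V j k = sqnorm ((U *m adjmx V) j k).
Proof. by rewrite /overlap -sqnorm_conj -adjmxE adjmxM adjmxK. Qed.

Lemma tr_cdiag_mul n (U V : 'M[C]_n) (x y : 'I_n -> R) :
  \tr ((adjmx U *m cdiag x *m U) *m (adjmx V *m cdiag y *m V)) =
  (\sum_j \sum_k overlap U V j k * x j * y k)%:C%C.
Proof.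
have -> : \tr ((adjmx U *m cdiag x *m U) *m (adjmx V *m cdiag y *m V)) =
    \tr (cdiag x *m (U *m adjmx V) *m cdiag y *m adjmx (U *m adjmx V)).
  by rewrite -!mulmxA mxtrace_mulC adjmxM adjmxK !mulmxA.
rewrite tr_cdiag_sandwich; congr (_%:C%C); apply: eq_bigr => j _.
by apply: eq_bigr => k _; rewrite overlapE mulrC mulrA.
Qed.

(** Parseval: row [j] of the unitary [U *m adjmx V] has norm one. *)
Lemma sum_overlap n (U V : 'M[C]_n) j :
  U *m adjmx U = 1%:M -> V *m adjmx V = 1%:M -> \sum_k overlap U V j k = 1.
Proof.
move=> UU /mulmx1C VV; apply: (@complexI R); rewrite rmorph_sum /= -[RHS]/(1 : C).
have -> : (1 : C) = ((U *m adjmx V) *m adjmx (U *m adjmx V)) j j.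
  by rewrite adjmxM adjmxK mulmxA -(mulmxA U) VV mulmx1 UU mxE eqxx.
by rewrite mxE; apply: eq_bigr => k _; rewrite adjmxE sqnormE overlapE.
Qed.

(** The functional of [K] in the variational formula. It is additive in the pair of states, which
    [ent_mixed_condst_le] exploits. *)
Definition vform n (s : R) (rho sigma K : 'M[C]_n) : R :=
  2 * Re (\tr (K *m rho)) - (1 - s) * Re (\tr (K *m sigma *m adjmx K))
  - s * Re (\tr (adjmx K *m rho *m K)).

(** In the coordinates [L] the functional splits into one scalar quadratic per entry, so it can be
    maximised entry by entry. *)
Lemma vform_diag n s (U V : 'M[C]_n) a b rho sigma (L : 'M[C]_n) :
  diagonalizes U a rho -> diagonalizes V b sigma ->
  vform s rho sigma (adjmx U *m L *m V) =
  \sum_j \sum_k (2 * a j * Re (L j k * (V *m adjmx U) k j)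
                 - ((1 - s) * b k + s * a j) * sqnorm (L j k)).
Proof.
move=> dU dV; have VV := diagonalizesV dV; have UU := diagonalizesV dU.
have [UU' _ rhoE] := dU; have [VV' _ sigmaE] := dV.
have conj_tr (W X : 'M[C]_n) : W *m adjmx W = 1%:M ->
    \tr (adjmx W *m X *m W) = \tr X.
  by move=> WW; rewrite mxtrace_mulC mulmxA WW mul1mx.
have t1 : Re (\tr (adjmx U *m L *m V *m rho)) =
    \sum_j \sum_k a j * Re (L j k * (V *m adjmx U) k j).
  have -> : \tr (adjmx U *m L *m V *m rho) =
      \tr (cdiag a *m (L *m (V *m adjmx U))).
    rewrite rhoE -!mulmxA mxtrace_mulC -!mulmxA UU' mulmx1 !mulmxA.
    by rewrite [LHS]mxtrace_mulC !mulmxA.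
  rewrite Re_sum; apply: eq_bigr => j _.
  rewrite mul_diag_mx !mxE ReZ Re_sum mulr_sumr; apply: eq_bigr => k _.
  by rewrite mxE.
have t2 : Re (\tr (adjmx U *m L *m V *m sigma *m adjmx (adjmx U *m L *m V))) =
    \sum_j \sum_k b k * sqnorm (L j k).
  have -> : \tr (adjmx U *m L *m V *m sigma *m adjmx (adjmx U *m L *m V)) =
      \tr (cdiag (fun=> 1) *m L *m cdiag b *m adjmx L).
    rewrite (_ : cdiag (fun=> 1) = 1%:M); last first.
      by apply/matrixP => i j; rewrite !mxE.
    rewrite mul1mx -(diagonalizesK dV) -[RHS](conj_tr U) //.
    by congr (\tr _); rewrite !adjmxM adjmxK !mulmxA.
  rewrite tr_cdiag_sandwich /=; apply: eq_bigr => j _.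
  by apply: eq_bigr => k _; rewrite mul1r.
have t3 : Re (\tr (adjmx (adjmx U *m L *m V) *m rho *m (adjmx U *m L *m V))) =
    \sum_j \sum_k a j * sqnorm (L j k).
  have -> : \tr (adjmx (adjmx U *m L *m V) *m rho *m (adjmx U *m L *m V)) =
      \tr (cdiag a *m L *m cdiag (fun=> 1) *m adjmx L).
    rewrite (_ : cdiag (fun=> 1) = 1%:M); last first.
      by apply/matrixP => i j; rewrite !mxE.
    rewrite mulmx1 [RHS]mxtrace_mulC -(diagonalizesK dU) -[RHS](conj_tr V) //.
    by congr (\tr _); rewrite !adjmxM adjmxK !mulmxA.
  rewrite tr_cdiag_sandwich /=; apply: eq_bigr => j _.
  by apply: eq_bigr => k _; rewrite mulr1.
rewrite /vform t1 t2 t3 !mulr_sumr -!sumrB; apply: eq_bigr => j _.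
rewrite !mulr_sumr -!sumrB; apply: eq_bigr => k _; ring.
Qed.

(** The maximum of [vform], in the weight-times-ratio shape that [le_sum_ln_ratio] expects. Terms
    with zero denominator are 0. *)
Definition qform n (s : R) (U V : 'M[C]_n) (a b : 'I_n -> R) : R :=
  \sum_j \sum_k overlap U V j k * a j * (a j / ((1 - s) * b k + s * a j)).

Lemma vform_le_qform n s (U V : 'M[C]_n) a b rho sigma (K : 'M[C]_n) :
  0 < s < 1 -> diagonalizes U a rho -> diagonalizes V b sigma ->
  vform s rho sigma K <= qform s U V a b.
Proof.
move=> /andP[s0 s1] dU dV.
have -> : K = adjmx U *m (U *m K *m adjmx V) *m V.
  by rewrite !mulmxA (diagonalizesV dU) mul1mx -mulmxA (diagonalizesV dV) mulmx1.
rewrite (vform_diag _ _ dU dV); apply: ler_sum => j _; apply: ler_sum => k _.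
have [_ a0 _] := dU; have [_ b0 _] := dV.
have {a0 b0} [a0 b0] := (a0 j, b0 k).
rewrite /overlap; move: ((_ *m _) j k) ((_ *m _) k j) => [x y] [u v].
rewrite /sqnorm /=; set d := (1 - s) * b k + s * a j.
have [d0|d0] := eqVneq d 0.
  (* Both summands of [d] are nonnegative and [s > 0], so [d = 0] forces [a j = 0], and both sides
     vanish. *)
  have -> : a j = 0 by rewrite /d in d0; nra.
  by rewrite d0; lra.
have {}d0 : 0 < d by rewrite lt_neqAle eq_sym d0 /d /=; nra.
rewrite -subr_ge0.
(* Completing the square: with [z = u + iv] and [l = x + iy], the gap is
   [|a_j conj(z) - d l|^2 / d]. *)
have -> : (u ^+ 2 + v ^+ 2) * a j * (a j / d) -
    (2 * a j * (x * u - y * v) - d * (x ^+ 2 + y ^+ 2)) =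
    ((u * a j - d * x) ^+ 2 + (v * a j + d * y) ^+ 2) / d.
  by field; exact: lt0r_neq0.
by apply: divr_ge0; [rewrite addr_ge0 ?sqr_ge0|exact: ltW].
Qed.

Lemma qform_attained n s (U V : 'M[C]_n) a b rho sigma :
  0 < s < 1 -> diagonalizes U a rho -> diagonalizes V b sigma ->
  exists K, vform s rho sigma K = qform s U V a b.
Proof.
move=> /andP[s0 s1] dU dV.
pose d j k := (1 - s) * b k + s * a j.
(* These entries make the square completed in [vform_le_qform] vanish. *)
exists (adjmx U *m (\matrix_(j, k)
   ((a j / d j k)%:C%C * Num.conj ((V *m adjmx U) k j))) *m V).
rewrite (vform_diag _ _ dU dV); apply: eq_bigr => j _; apply: eq_bigr => k _.
have [_ a0 _] := dU; have [_ b0 _] := dV.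
have {a0 b0} [a0 b0] := (a0 j, b0 k).
rewrite [(\matrix_(_, _) _) j k]mxE -/(d j k) /overlap; move: ((_ *m _) k j) => [u v].
rewrite conjE /sqnorm /=.
have [d0|d0] := eqVneq (d j k) 0.
  have -> : a j = 0 by rewrite /d in d0; nra.
  by rewrite d0; ring.
by field.
Qed.

(* The relative entropy is computed from arbitrary diagonalizations, so that
   rescaling [sigma] only rescales [b]; [mxlog] commits to the one chosen by
   [spectralmx], which may change under rescaling. *)
Definition ent n (U V : 'M[C]_n) (a b : 'I_n -> R) : R :=
  \sum_j \sum_k overlap U V j k * a j * (ln (a j) - ln (b k)).

(** Turns equality of traces into the equal-weights hypothesis of [le_sum_ln_ratio]. *)
Lemma sum_overlap_weight n (U V : 'M[C]_n) a b rho sigma :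
  diagonalizes U a rho -> diagonalizes V b sigma ->
  \sum_j \sum_k overlap U V j k * a j = Re (\tr rho).
Proof.
move=> [UU _ rhoE] [VV _ _].
rewrite rhoE -mulmxA mxtrace_mulC -mulmxA UU mulmx1 mxtrace_diag Re_sum.
by apply: eq_bigr => j _; rewrite -mulr_suml sum_overlap // mul1r mxE.
Qed.

Lemma qrelent_ent n (rho sigma : 'M[C]_n) : psdmx rho -> psdmx sigma ->
  Re (\tr (rho *m mxlog rho) - \tr (rho *m mxlog sigma)) =
  ent (spectralmx rho) (spectralmx sigma) (evals rho) (evals sigma).
Proof.
move=> /psdmx_diagonalizes[UU a0 rhoE] /psdmx_diagonalizes[VV b0 sigmaE].
have logE (A : 'M[C]_n) : mxlog A =
    adjmx (spectralmx A) *m cdiag (fun j => ln (evals A j)) *m spectralmx A.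
  by rewrite /mxlog /mxfun invmx_unitary ?spectral_unitarymx.
(* Inserting [sum_overlap] spreads this trace over the same double index as the mixed one. *)
have -> : \tr (rho *m mxlog rho) = (\sum_j \sum_k overlap (spectralmx rho)
    (spectralmx sigma) j k * evals rho j * ln (evals rho j))%:C%C.
  rewrite logE {1}rhoE -!mulmxA mxtrace_mulC -!mulmxA UU mulmx1.
  rewrite (mulmxA (spectralmx rho)) UU mul1mx mulmx_diag mxtrace_diag rmorph_sum.
  apply: eq_bigr => j _.
  by rewrite -!mulr_suml sum_overlap // mul1r !mxE -rmorphM.
have -> : \tr (rho *m mxlog sigma) = (\sum_j \sum_k overlap (spectralmx rho)
    (spectralmx sigma) j k * evals rho j * ln (evals sigma k))%:C%C.
  by rewrite logE {1}rhoE tr_cdiag_mul.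
rewrite ReB /= -sumrB; apply: eq_bigr => j _.
by rewrite -sumrB; apply: eq_bigr => k _; rewrite -mulrBr.
Qed.

(** Support inclusion through quadratic forms, which pass directly to conditional states. For
    positive matrices it agrees with the row-space condition of [qrelent] ([submx_dominated],
    [dominated_submx]). *)
Definition dominated n (rho sigma : 'M[C]_n) :=
  forall v : 'rV[C]_n, (v *m sigma *m adjmx v) 0 0 = 0 ->
    (v *m rho *m adjmx v) 0 0 = 0.

(** If [b k = 0], the form of [sigma], hence that of [rho], vanishes at row [k] of [V]. The latter
    value is the sum over [l] of the nonnegative [overlap U V l k * a l], so each is zero:
    logarithms of zero carry no weight. *)
Lemma dominated_overlap n (U V : 'M[C]_n) a b rho sigma :
  diagonalizes U a rho -> diagonalizes V b sigma -> dominated rho sigma ->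
  forall j k, overlap U V j k * a j != 0 -> 0 < a j /\ 0 < b k.
Proof.
move=> dU dV dom j k; rewrite mulf_eq0 negb_or => /andP[o0 aj0].
have [UU a0 rhoE] := dU; have [VV b0 sigmaE] := dV.
split; first by rewrite lt_neqAle eq_sym aj0 a0.
rewrite lt_neqAle b0 andbT eq_sym; apply/eqP => bk0.
have /dom : (row k V *m sigma *m adjmx (row k V)) 0 0 = 0.
  by rewrite -quad_mulmx (diagonalizesK dV) mxE eqxx mxE bk0.
rewrite -quad_mulmx rhoE !mulmxA -(mulmxA _ U) [LHS]mxE => h.
have : \sum_l overlap U V l k * a l = 0.
  apply: (@complexI R); rewrite -[RHS]h rmorph_sum; apply: eq_bigr => l _.
  have -> : (U *m adjmx V) l k = Num.conj ((V *m adjmx U) k l).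
    by rewrite -adjmxE adjmxM adjmxK.
  rewrite mul_mx_diag [(\matrix_(_, _) _) k l]mxE [(\row__ _) 0 l]mxE.
  by rewrite rmorphM /= -sqnormE mulrAC.
move/eqP; rewrite psumr_eq0; last first.
  by move=> l _; rewrite mulr_ge0 ?overlap_ge0.
by move/allP/(_ j); rewrite mem_index_enum mulf_eq0 (negPf o0) (negPf aj0) => /(_ isT).
Qed.

End Variational.

(** * Monotonicity, supports and partial traces *)

Section Monotonicity.
Variable R : realType.
Local Notation C := R[i].
Local Notation Re := (@complex.Re R).

(** Monotonicity in abstract form: for each [s], the optimal [K'] is pulled back to some [K], whose
    value is at most [qform]; [le_sum_ln_ratio] passes from these inequalities to the entropies. *)
Lemma le_sum_ent (I J : finType) n m
    (U V : I -> 'M[C]_n) (a b : I -> 'I_n -> R) (rho sigma : I -> 'M[C]_n)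
    (U' V' : J -> 'M[C]_m) (a' b' : J -> 'I_m -> R) (rho' sigma' : J -> 'M[C]_m) :
  (forall i, diagonalizes (U i) (a i) (rho i)) ->
  (forall i, diagonalizes (V i) (b i) (sigma i)) ->
  (forall i, dominated (rho i) (sigma i)) ->
  (forall j, diagonalizes (U' j) (a' j) (rho' j)) ->
  (forall j, diagonalizes (V' j) (b' j) (sigma' j)) ->
  (forall j, dominated (rho' j) (sigma' j)) ->
  \sum_i Re (\tr (rho i)) = \sum_j Re (\tr (rho' j)) ->
  (forall s (K' : J -> 'M[C]_m), 0 < s < 1 -> exists K : I -> 'M[C]_n,
     \sum_j vform s (rho' j) (sigma' j) (K' j) <=
     \sum_i vform s (rho i) (sigma i) (K i)) ->
  \sum_j ent (U' j) (V' j) (a' j) (b' j) <= \sum_i ent (U i) (V i) (a i) (b i).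
Proof.
move=> dU dV dom dU' dV' dom' tr_eq hV.
have flat (T : finType) k (F : T -> 'I_k -> 'I_k -> R) :
    \sum_t \sum_j \sum_l F t j l = \sum_(p : T * 'I_k * 'I_k) F p.1.1 p.1.2 p.2.
  by rewrite pair_bigA pair_bigA.
rewrite /ent !flat; apply: le_sum_ln_ratio.
- by move=> i /(dominated_overlap (dU _) (dV _) (dom _))[].
- by move=> i /(dominated_overlap (dU _) (dV _) (dom _))[].
- by move=> i /(dominated_overlap (dU' _) (dV' _) (dom' _))[].
- by move=> i /(dominated_overlap (dU' _) (dV' _) (dom' _))[].
- rewrite -(flat _ _ (fun i j k => overlap (U i) (V i) j k * a i j)).
  rewrite -(flat _ _ (fun i j k => overlap (U' i) (V' i) j k * a' i j)).
  under eq_bigr => i _ do rewrite (sum_overlap_weight (dU i) (dV i)).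
  by under [RHS]eq_bigr => i _ do rewrite (sum_overlap_weight (dU' i) (dV' i)).
- move=> s s01.
  rewrite -(flat _ _ (fun i j k => overlap (U i) (V i) j k * a i j *
    (a i j / ((1 - s) * b i k + s * a i j)))).
  rewrite -(flat _ _ (fun i j k => overlap (U' i) (V' i) j k * a' i j *
    (a' i j / ((1 - s) * b' i k + s * a' i j)))).
  have /boolp.choice[K' K'E] j := qform_attained s01 (dU' j) (dV' j).
  have [K KE] := hV s K' s01.
  under eq_bigr => j _ do rewrite -/(qform s (U' j) (V' j) (a' j) (b' j)) -K'E.
  apply: le_trans KE _; apply: ler_sum => i _.
  exact: vform_le_qform s01 (dU i) (dV i).
Qed.

(** * Supports of positive matrices *)

Lemma tr_gram_eq0 m n (X : 'M[C]_(m, n)) : \tr (adjmx X *m X) = 0 -> X = 0.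
Proof.
rewrite mxtrace_mulC => h; apply/matrixP => i j; rewrite mxE.
have h2 : \sum_i \sum_j sqnorm (X i j) = 0.
  apply: (@complexI R); rewrite -[RHS]h rmorph_sum; apply: eq_bigr => k _.
  by rewrite rmorph_sum mxE; apply: eq_bigr => l _; rewrite adjmxE sqnormE.
have /eqP := h2; rewrite psumr_eq0 => [|k _]; last first.
  by apply: sumr_ge0 => l _; exact: sqnorm_ge0.
move/allP/(_ i); rewrite mem_index_enum => /(_ isT) /=.
rewrite psumr_eq0 => [|l _]; last exact: sqnorm_ge0.
move/allP/(_ j); rewrite mem_index_enum => /(_ isT) /=.
case: (X i j) => x y; rewrite /sqnorm /= paddr_eq0 ?sqr_ge0 // !sqrf_eq0.
by move=> /andP[/eqP -> /eqP ->].
Qed.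

(** With [A] written as [adjmx B *m B], the trace is the squared Frobenius norm of
    [B *m adjmx N]. *)
Lemma psdmx_quad_eq0 m n (A : 'M[C]_n) (N : 'M[C]_(m, n)) :
  psdmx A -> \tr (N *m A *m adjmx N) = 0 -> A *m adjmx N = 0.
Proof.
move=> /psdmx_gram[B ->] h; rewrite -mulmxA (@tr_gram_eq0 _ _ (B *m adjmx N)) ?mulmx0 //.
by rewrite -[RHS]h adjmxM adjmxK !mulmxA.
Qed.

Lemma submx_dominated n (rho sigma : 'M[C]_n) :
  psdmx sigma -> (rho <= sigma)%MS -> dominated rho sigma.
Proof.
move=> ps /submxP[X ->] v h.
rewrite mulmxA -mulmxA psdmx_quad_eq0 ?mulmx0 ?mxE //.
by rewrite /mxtrace big_ord1.
Qed.

Lemma dominated_submx n (rho sigma : 'M[C]_n) :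
  psdmx rho -> dominated rho sigma -> (rho <= sigma)%MS.
Proof.
move=> pr dom; rewrite submxE; apply/eqP.
(* [sigma] annihilates the columns of [cokermx sigma], so domination makes the form of [rho] vanish
   on their adjoints. *)
rewrite -[cokermx sigma]adjmxK; apply: psdmx_quad_eq0 => //.
rewrite tr_quad big1 // => i _; apply: dom.
by rewrite -quad_mulmx -mulmxA adjmxK mulmx_coker mulmx0 mxE.
Qed.

Lemma dominated_tr m n (rho sigma : 'M[C]_n) (N : 'M[C]_(m, n)) :
  psdmx sigma -> dominated rho sigma ->
  \tr (N *m sigma *m adjmx N) = 0 -> \tr (N *m rho *m adjmx N) = 0.
Proof.
move=> ps dom /eqP; rewrite !tr_quad psumr_eq0 // => /allP h.
rewrite big1 // => i _; apply: dom; apply/eqP.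
by have := h i; rewrite mem_index_enum => /(_ isT).
Qed.

Lemma psdmx_tr0 n (A : 'M[C]_n) : psdmx A -> \tr A = 0 -> A = 0.
Proof.
move=> pA h; rewrite -[A]mulmx1 -adjmx1; apply: psdmx_quad_eq0 => //.
by rewrite adjmx1 mulmx1 mul1mx.
Qed.

(** * Tensor products and partial traces *)

Lemma sum_mxtens_index (V : nmodType) n m (F : 'I_(n * m) -> V) :
  \sum_p F p = \sum_i \sum_k F (mxtens_index (i, k)).
Proof.
rewrite (reindex (@mxtens_index n m)) /=; last first.
  by exists (@mxtens_unindex n m) => p _; rewrite ?mxtens_indexK ?mxtens_unindexK.
by rewrite pair_bigA; apply: eq_bigr => -[].
Qed.

Lemma tens_suml n m (I : Type) (r : seq I) (P : pred I) (F : I -> 'M[C]_n)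
    (B : 'M[C]_m) :
  (\sum_(i <- r | P i) F i) *t B = \sum_(i <- r | P i) (F i *t B).
Proof.
apply/matrixP => p q; case: (mxtens_indexP p) => i k; case: (mxtens_indexP q) => j l.
rewrite tensmxE !summxE mulr_suml; apply: eq_bigr => t _.
by rewrite tensmxE.
Qed.

Lemma tens11 n m : (1%:M : 'M[C]_n) *t (1%:M : 'M[C]_m) = 1%:M.
Proof.
apply/matrixP => p q; case: (mxtens_indexP p) => i k; case: (mxtens_indexP q) => j l.
rewrite tensmxE !mxE (can_eq (@mxtens_indexK n m)) xpair_eqE.
by case: eqP; case: eqP; rewrite ?(mulr1, mul1r, mulr0, mul0r).
Qed.

Lemma ptraceX_sum n m (I : Type) (r : seq I) (P : pred I) (F : I -> 'M[C]_(n * m)) :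
  ptraceX (\sum_(i <- r | P i) F i) = \sum_(i <- r | P i) ptraceX (F i).
Proof.
apply/matrixP => k l; rewrite mxE summxE.
under [RHS]eq_bigr => i _ do rewrite mxE.
by rewrite exchange_big; apply: eq_bigr => i _; rewrite summxE.
Qed.

Lemma tr_mul_ptraceX n m (B : 'M[C]_m) (W : 'M[C]_(n * m)) :
  \tr (B *m ptraceX W) = \tr ((1%:M *t B) *m W).
Proof.
rewrite [RHS]/mxtrace sum_mxtens_index exchange_big; apply: eq_bigr => k _ /=.
under eq_bigr => i _.
  rewrite mxE sum_mxtens_index (bigD1 i) //= [X in _ + X]big1 ?addr0; last first.
    move=> j ji; rewrite big1 // => l _.
    by rewrite tensmxE mxE eq_sym (negPf ji) !mul0r.
  under eq_bigr => l _ do rewrite tensmxE mxE eqxx mul1r.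
  over.
rewrite exchange_big mxE; apply: eq_bigr => l _ /=.
by rewrite mxE mulr_sumr.
Qed.

Lemma tr_tens_mul n m (A : 'M[C]_n) (B : 'M[C]_m) (Z : 'M[C]_(n * m)) :
  \tr ((A *t B) *m Z) = \tr (B *m ptraceX ((A *t 1%:M) *m Z)).
Proof. by rewrite tr_mul_ptraceX mulmxA tensmx_mul mul1mx mulmx1. Qed.

Lemma tr_mul_ptraceY n m (A : 'M[C]_n) (Z : 'M[C]_(n * m)) :
  \tr (A *m ptraceY Z) = \tr ((A *t 1%:M) *m Z).
Proof.
rewrite [RHS]/mxtrace sum_mxtens_index; apply: eq_bigr => i _.
rewrite mxE; under eq_bigr => j _ do rewrite mxE mulr_sumr.
rewrite exchange_big; apply: eq_bigr => k _ /=.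
rewrite mxE sum_mxtens_index; apply: eq_bigr => j _.
rewrite (bigD1 k) //= tensmxE mxE eqxx mulr1 big1 ?addr0 // => l lk.
by rewrite tensmxE mxE eq_sym (negPf lk) mulr0 mul0r.
Qed.

End Monotonicity.

(** * Measuring one subsystem *)

Section Measurement.
Variables (R : realType) (n m : nat) (M : meas R n).
Hypothesis povmM : is_povm M.
Local Notation C := R[i].
Local Notation Re := (@complex.Re R).
Local Notation I := 'I_(meas_card M).
Implicit Types (Z rho sigma : 'M[C]_(n * m)) (i : I).

(** The unnormalized [rho^i] of the overview. The product inside need not be hermitian, but for
    positive [Z] its partial trace is positive ([psd_condst]). *)
Definition condst Z (i : I) : 'M[C]_m :=
  ptraceX ((meas_op M i *t (1%:M : 'M[C]_m)) *m Z).

Lemma psd_meas_op i : psdmx (meas_op M i).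
Proof. by case: povmM. Qed.

Lemma sum_condst Z : \sum_i condst Z i = ptraceX Z.
Proof.
rewrite /condst -ptraceX_sum -mulmx_suml -tens_suml.
by case: povmM => _ ->; rewrite tens11 mul1mx.
Qed.

Lemma tr_condst Z i : \tr (condst Z i) = \tr ((meas_op M i *t (1%:M : 'M[C]_m)) *m Z).
Proof. by rewrite -[condst Z i]mul1mx -tr_tens_mul. Qed.

Lemma meas_prob_condst Z i : meas_prob M (ptraceY Z) i = Re (\tr (condst Z i)).
Proof. by rewrite /meas_prob tr_mul_ptraceY tr_condst. Qed.

(** [B] is a Gram factor of the effect. Being independent of [Z], it transfers domination between
    two states as well as positivity. *)
Lemma condst_quad i : exists B : 'M[C]_n, forall (v : 'rV[C]_m) Z,
  (v *m condst Z i *m adjmx v) 0 0 = \tr ((B *t v) *m Z *m adjmx (B *t v)).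
Proof.
have [B BE] := psdmx_gram (psd_meas_op i); exists B => v Z.
have -> : (v *m condst Z i *m adjmx v) 0 0 = \tr (v *m condst Z i *m adjmx v).
  by rewrite /mxtrace big_ord1.
rewrite mxtrace_mulC mulmxA -tr_tens_mul BE [RHS]mxtrace_mulC mulmxA.
by rewrite adjmx_tens tensmx_mul.
Qed.

Lemma psd_condst Z i : psdmx Z -> psdmx (condst Z i).
Proof. by move=> pZ v; have [B ->] := condst_quad i; exact: tr_quad_ge0. Qed.

Lemma dominated_condst rho sigma i :
  psdmx sigma -> dominated rho sigma -> dominated (condst rho i) (condst sigma i).
Proof.
by move=> ps dom v; have [B BE] := condst_quad i; rewrite !BE; exact: dominated_tr.
Qed.

(** The dual of [condst] (see [tr_povm_lift_mul]), a unital completely positive map. *)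
Definition povm_lift (K : I -> 'M[C]_m) : 'M[C]_(n * m) :=
  \sum_i meas_op M i *t K i.

Lemma tr_povm_lift_mul (K : I -> 'M[C]_m) Z :
  \tr (povm_lift K *m Z) = \sum_i \tr (K i *m condst Z i).
Proof.
rewrite /povm_lift mulmx_suml raddf_sum.
by apply: eq_bigr => i _; exact: tr_tens_mul.
Qed.

(* Kadison-Schwarz: the difference equals
   sum_i (1 (x) K_i - K) (M_i (x) 1) (1 (x) K_i - K)^* . *)
Lemma kadison_schwarz (K : I -> 'M[C]_m) :
  psdmx (povm_lift (fun i => K i *m adjmx (K i)) -
         povm_lift K *m adjmx (povm_lift K)).
Proof.
rewrite {1}/povm_lift; set KK := povm_lift K; pose D i := (1%:M : 'M[C]_n) *t K i - KK.
have -> : \sum_i meas_op M i *t (K i *m adjmx (K i)) - KK *m adjmx KK =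
    \sum_i D i *m (meas_op M i *t (1%:M : 'M[C]_m)) *m adjmx (D i).
  have DE i : D i *m (meas_op M i *t (1%:M : 'M[C]_m)) *m adjmx (D i) =
      meas_op M i *t (K i *m adjmx (K i)) - (meas_op M i *t K i) *m adjmx KK
      - KK *m adjmx (meas_op M i *t K i)
      + KK *m (meas_op M i *t (1%:M : 'M[C]_m)) *m adjmx KK.
    have AM : ((1%:M : 'M[C]_n) *t K i) *m (meas_op M i *t (1%:M : 'M[C]_m)) =
        meas_op M i *t K i by rewrite tensmx_mul mul1mx mulmx1.
    have MA : (meas_op M i *t (1%:M : 'M[C]_m)) *m adjmx ((1%:M : 'M[C]_n) *t K i) =
        adjmx (meas_op M i *t K i).
      by rewrite !adjmx_tens tensmx_mul adjmx1 mul1mx mulmx1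
        (psdmx_herm (psd_meas_op i)).
    have AMA : (meas_op M i *t K i) *m adjmx ((1%:M : 'M[C]_n) *t K i) =
        meas_op M i *t (K i *m adjmx (K i)).
      by rewrite adjmx_tens tensmx_mul adjmx1 mulmx1.
    rewrite /D adjmxB mulmxBl AM mulmxBl !mulmxBr AMA -(mulmxA KK _ (adjmx (_ *t _))) MA.
    by rewrite opprB !addrA [RHS]addrAC.
  under [RHS]eq_bigr => i _ do rewrite DE.
  (* As the effects sum to 1, the last three terms of [DE] sum to two negative copies and one
     positive copy of [KK *m adjmx KK]. *)
  rewrite big_split /= !sumrB -!mulmx_suml -!mulmx_sumr -tens_suml -adjmx_sum.
  case: povmM => _ ->; rewrite tens11 mulmx1 -/KK.
  by rewrite subrK.
apply: psdmx_sum => i _; apply: psdmx_quad.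
have [B ->] := psdmx_gram (psd_meas_op i).
have -> : (adjmx B *m B) *t (1%:M : 'M[C]_m) =
    adjmx (B *t (1%:M : 'M[C]_m)) *m (B *t (1%:M : 'M[C]_m)).
  by rewrite adjmx_tens tensmx_mul adjmx1 mul1mx.
exact: gram_psdmx.
Qed.

Lemma tr_sqr_le_condst (K : I -> 'M[C]_m) Z : psdmx Z ->
  Re (\tr (povm_lift K *m adjmx (povm_lift K) *m Z)) <=
  \sum_i Re (\tr (K i *m adjmx (K i) *m condst Z i)).
Proof.
move=> pZ; have := tr_psdmx_mul_ge0 (kadison_schwarz K) pZ.
rewrite lecE => /andP[_]; rewrite mulmxBl raddfB /= ReB subr_ge0.
by rewrite tr_povm_lift_mul -Re_sum.
Qed.

(** Duality preserves the linear term. The quadratic terms enter negatively and are controlled by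
    [kadison_schwarz], applied to the adjoints of [K] for [sigma] and to [K] for [rho]. *)
Lemma sum_vform_condst s rho sigma (K : I -> 'M[C]_m) :
  0 < s < 1 -> psdmx rho -> psdmx sigma ->
  \sum_i vform s (condst rho i) (condst sigma i) (K i) <=
  vform s rho sigma (povm_lift K).
Proof.
move=> /andP[s0 s1] pr ps; set KK := povm_lift K.
have adjKK : adjmx KK = povm_lift (fun i => adjmx (K i)).
  rewrite adjmx_sum; apply: eq_bigr => i _.
  by rewrite adjmx_tens (psdmx_herm (psd_meas_op i)).
have e1 : Re (\tr (KK *m rho)) = \sum_i Re (\tr (K i *m condst rho i)).
  by rewrite tr_povm_lift_mul -Re_sum.
have e2 : Re (\tr (KK *m sigma *m adjmx KK)) <=
    \sum_i Re (\tr (K i *m condst sigma i *m adjmx (K i))).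
  have := tr_sqr_le_condst (fun i => adjmx (K i)) ps.
  rewrite -adjKK adjmxK -mulmxA mxtrace_mulC => /le_trans; apply.
  by apply: ler_sum => i _; rewrite adjmxK -mulmxA mxtrace_mulC.
have e3 : Re (\tr (adjmx KK *m rho *m KK)) <=
    \sum_i Re (\tr (adjmx (K i) *m condst rho i *m K i)).
  have := tr_sqr_le_condst K pr.
  rewrite -/KK -mulmxA mxtrace_mulC => /le_trans; apply.
  by apply: ler_sum => i _; rewrite -mulmxA mxtrace_mulC.
rewrite /vform !sumrB -!mulr_sumr -e1; nra.
Qed.

(** First use of monotonicity, for the measurement of [X]; the pair of states is a one-element
    family. *)
Lemma sum_ent_condst_le rho sigma : psdmx rho -> psdmx sigma -> dominated rho sigma ->
  \sum_i ent (spectralmx (condst rho i)) (spectralmx (condst sigma i))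
             (evals (condst rho i)) (evals (condst sigma i)) <=
  ent (spectralmx rho) (spectralmx sigma) (evals rho) (evals sigma).
Proof.
move=> pr ps dom.
have sum1 (x : R) : \sum_(j < 1) x = x by rewrite big_ord1.
rewrite -[leRHS]sum1; apply: (@le_sum_ent R 'I_1 I (n * m) m
  (fun=> spectralmx rho) (fun=> spectralmx sigma)
  (fun=> evals rho) (fun=> evals sigma) (fun=> rho) (fun=> sigma)
  (fun i => spectralmx (condst rho i)) (fun i => spectralmx (condst sigma i))
  (fun i => evals (condst rho i)) (fun i => evals (condst sigma i))
  (condst rho) (condst sigma)).
- by move=> _; exact: psdmx_diagonalizes.
- by move=> _; exact: psdmx_diagonalizes.
- by [].
- by move=> i; apply/psdmx_diagonalizes/psd_condst.
- by move=> i; apply/psdmx_diagonalizes/psd_condst.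
- by move=> i; exact: dominated_condst.
- rewrite big_ord1 -Re_sum -raddf_sum /= sum_condst.
  by rewrite -[ptraceX rho]mul1mx tr_mul_ptraceX tens11 mul1mx.
- move=> s K' s01; exists (fun=> povm_lift K').
  by rewrite big_ord1; exact: sum_vform_condst.
Qed.

(** * The averaged conditional state *)

Variables rho sigma : 'M[C]_(n * m).
Hypotheses (psd_rho : psdmx rho) (psd_sigma : psdmx sigma).
Hypothesis dom : dominated rho sigma.

Local Notation p := (meas_prob M (ptraceY rho)).
Local Notation q := (meas_prob M (ptraceY sigma)).

(** The [tau] of the overview: normalized conditional states of [sigma] weighted by the outcome
    probabilities of [rho]. Terms with [q i = 0] drop out, the quotient being 0. *)
Definition mixed_condst : 'M[C]_m := \sum_i ((p i / q i)%:C)%C *: condst sigma i.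

Lemma meas_prob_ptraceYE Z i : psdmx Z ->
  (meas_prob M (ptraceY Z) i)%:C%C = \tr (condst Z i).
Proof.
move=> pZ; rewrite meas_prob_condst; have [] // := @ge0_Re R (\tr (condst Z i)).
by rewrite -[condst Z i]mulmx1 -adjmx1 -[condst Z i]mul1mx tr_quad_ge0 //;
   exact: psd_condst.
Qed.

Lemma meas_prob_ptraceY_ge0 Z i : psdmx Z -> 0 <= meas_prob M (ptraceY Z) i.
Proof.
move=> pZ; rewrite -ler0c meas_prob_ptraceYE //.
by rewrite -[condst Z i]mulmx1 -adjmx1 -[condst Z i]mul1mx tr_quad_ge0 //;
   exact: psd_condst.
Qed.

Lemma condst_eq0 i : p i = 0 -> condst rho i = 0.
Proof.
move=> p0; apply: psdmx_tr0; first exact: psd_condst.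
by rewrite -meas_prob_ptraceYE // p0.
Qed.

(** A positive matrix of trace zero is zero, so [q i = 0] kills [condst sigma i], and domination
    then kills the trace of [condst rho i]. *)
Lemma meas_prob_dominated i : 0 < p i -> 0 < q i.
Proof.
move=> p0; rewrite lt_neqAle meas_prob_ptraceY_ge0 // andbT eq_sym.
apply: contraL p0 => /eqP q0; rewrite -leNgt meas_prob_condst.
have s0 : condst sigma i = 0.
  by apply: psdmx_tr0; [exact: psd_condst|rewrite -meas_prob_ptraceYE // q0].
have := dominated_tr (N := 1%:M) (psd_condst i psd_sigma)
  (dominated_condst (i := i) psd_sigma dom).
by rewrite s0 mulmx0 mul0mx mxtrace0 adjmx1 mulmx1 mul1mx => ->.
Qed.

Lemma ratio_ge0 i : 0 <= p i / q i.
Proof. by rewrite divr_ge0 // meas_prob_ptraceY_ge0. Qed.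

Lemma psd_scaled_condst i : psdmx (((p i / q i)%:C)%C *: condst sigma i).
Proof. by apply: psdmxZ; [exact: ratio_ge0|exact: psd_condst]. Qed.

Lemma psd_mixed_condst : psdmx mixed_condst.
Proof. by apply: psdmx_sum => i _; exact: psd_scaled_condst. Qed.

Lemma psd_ptraceX Z : psdmx Z -> psdmx (ptraceX Z).
Proof.
by move=> pZ; rewrite -sum_condst; apply: psdmx_sum => i _; exact: psd_condst.
Qed.

Lemma dominated_scaled_condst i :
  dominated (condst rho i) (((p i / q i)%:C)%C *: condst sigma i).
Proof.
(* If [p i = 0] the scaled state is zero, but so is [condst rho i]; otherwise the factor is positive
   and cancels. *)
have := meas_prob_ptraceY_ge0 i psd_rho; rewrite le_eqVlt => /orP[/eqP p0|p0].
  by move=> v _; rewrite condst_eq0 // mulmx0 mul0mx mxE.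
have q0 := meas_prob_dominated p0.
move=> v; rewrite -scalemxAr -scalemxAl mxE => /eqP; rewrite mulf_eq0.
rewrite (_ : (_%:C%C == 0 :> C) = false); last first.
  by rewrite eq_complex /= eqxx andbT gt_eqF // divr_gt0.
by move=> /eqP; exact: dominated_condst.
Qed.

Lemma dominated_mixed_condst : dominated (ptraceX rho) mixed_condst.
Proof.
move=> v; rewrite /mixed_condst -sum_condst !mulmx_sumr !mulmx_suml !summxE.
move=> /eqP; rewrite psumr_eq0 => [|i _]; last exact: psd_scaled_condst.
move=> /allP h; rewrite big1 // => i _; apply: dominated_scaled_condst; apply/eqP.
by have := h i; rewrite mem_index_enum => /(_ isT).
Qed.

Lemma diagonalizes_scaled_condst i :
  diagonalizes (spectralmx (condst sigma i))
    (fun k => p i / q i * evals (condst sigma i) k)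
    (((p i / q i)%:C)%C *: condst sigma i).
Proof.
have [VV b0 sE] := psdmx_diagonalizes (psd_condst i psd_sigma).
split=> // [j|]; first by rewrite mulr_ge0 // ratio_ge0.
rewrite {1}sE scalemxAl scalemxAr; congr (_ *m _ *m _).
apply/matrixP => j k; rewrite !mxE mulrnAr; congr (_ *+ _).
by rewrite [RHS]rmorphM.
Qed.

(** Second use of monotonicity, for the map that forgets the outcome and sums the family. *)
Lemma ent_mixed_condst_le :
  ent (spectralmx (ptraceX rho)) (spectralmx mixed_condst)
      (evals (ptraceX rho)) (evals mixed_condst) <=
  \sum_i ent (spectralmx (condst rho i)) (spectralmx (condst sigma i))
     (evals (condst rho i)) (fun k => p i / q i * evals (condst sigma i) k).
Proof.
have sum1 (x : R) : \sum_(j < 1) x = x by rewrite big_ord1.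
rewrite -[leLHS]sum1; apply: (@le_sum_ent R I 'I_1 m m
  (fun i => spectralmx (condst rho i)) (fun i => spectralmx (condst sigma i))
  (fun i => evals (condst rho i)) (fun i k => p i / q i * evals (condst sigma i) k)
  (condst rho) (fun i => ((p i / q i)%:C)%C *: condst sigma i)
  (fun=> spectralmx (ptraceX rho)) (fun=> spectralmx mixed_condst)
  (fun=> evals (ptraceX rho)) (fun=> evals mixed_condst)
  (fun=> ptraceX rho) (fun=> mixed_condst)).
- by move=> i; apply/psdmx_diagonalizes/psd_condst.
- exact: diagonalizes_scaled_condst.
- exact: dominated_scaled_condst.
- by move=> _; apply/psdmx_diagonalizes/psd_ptraceX.
- by move=> _; apply/psdmx_diagonalizes/psd_mixed_condst.
- by move=> _; exact: dominated_mixed_condst.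
- by rewrite big_ord1 -Re_sum -raddf_sum /= sum_condst.
(* The dual of summation is the constant family, and additivity of [vform] gives equality. *)
- move=> s K' _; exists (fun=> K' ord0); rewrite big_ord1 /vform.
  rewrite !sumrB -!mulr_sumr -!Re_sum -!raddf_sum /= -!mulmx_suml -!mulmx_sumr.
  by rewrite !sum_condst.
Qed.

(** The logarithm splits off [ln (p i / q i)] wherever the weight is nonzero, and the total weight
    is [p i]. *)
Lemma ent_scaled_condst i :
  ent (spectralmx (condst rho i)) (spectralmx (condst sigma i))
     (evals (condst rho i)) (fun k => p i / q i * evals (condst sigma i) k) =
  ent (spectralmx (condst rho i)) (spectralmx (condst sigma i))
     (evals (condst rho i)) (evals (condst sigma i)) - p i * ln (p i / q i).
Proof.
have dr := psdmx_diagonalizes (psd_condst i psd_rho).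
have ds := psdmx_diagonalizes (psd_condst i psd_sigma).
have ov := dominated_overlap dr ds (dominated_condst (i := i) psd_sigma dom).
have pE := meas_prob_condst rho i; rewrite -(sum_overlap_weight dr ds) in pE.
rewrite [X in _ = _ - X * _]pE mulr_suml /ent -sumrB.
apply: eq_bigr => j _; rewrite mulr_suml -sumrB; apply: eq_bigr => k _.
have [->|w0] := eqVneq (overlap (spectralmx (condst rho i))
  (spectralmx (condst sigma i)) j k * evals (condst rho i) j) 0.
  by rewrite !mul0r subr0.
have [a0 b0] := ov _ _ w0.
have r0 : 0 < p i / q i.
  have [_] := dominated_overlap dr (diagonalizes_scaled_condst i)
    (@dominated_scaled_condst i) w0.
  by rewrite pmulr_lgt0.
rewrite lnM ?posrE //; ring.
Qed.

End Measurement.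

(** * Convex combinations and superadditivity *)

Lemma convex_states_sum (R : realType) n (P : set 'M[R[i]]_n) (I : finType)
    (w : I -> R) (x : I -> 'M[R[i]]_n) :
  convex_states P -> (forall i, 0 <= w i) -> (forall i, 0 < w i -> P (x i)) ->
  \sum_i w i = 1 -> P (\sum_i (w i)%:C%C *: x i).
Proof.
move=> [_ cvx] w0 Px w1.
(* Two-point convexity needs members of [P], so the induction carries normalized partial sums. Zero
   weights are skipped, since there [x i] may lie outside [P]. *)
suff norm_sum (r : seq I) : 0 < \sum_(i <- r) w i ->
    P ((\sum_(i <- r) w i)^-1%:C%C *: \sum_(i <- r) (w i)%:C%C *: x i).
  by have := norm_sum (index_enum I); rewrite w1 invr1 scale1r; apply.
elim: r => [|i r ih]; first by rewrite big_nil ltxx.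
rewrite !big_cons => W0.
have := w0 i; rewrite le_eqVlt => /orP[/eqP wi0|wi0].
  by move: W0; rewrite -wi0 scale0r !add0r.
have : 0 <= \sum_(j <- r) w j by exact: sumr_ge0.
rewrite le_eqVlt => /orP[/eqP W'0|W'0].
  have -> : \sum_(j <- r) (w j)%:C%C *: x j = 0.
    have /eqP := esym W'0; rewrite psumr_eq0 // => /allP h.
    by apply: big1_seq => j /andP[_ /h /eqP ->]; rewrite scale0r.
  rewrite -W'0 !addr0 scalerA -rmorphM /= mulVf ?gt_eqF // scale1r.
  exact: Px.
set W' := \sum_(j <- r) w j in W0 W'0 ih *.
have l01 : 0 <= w i / (w i + W') <= 1.
  apply/andP; split; first by apply: divr_ge0; exact: ltW.
  by rewrite ler_pdivrMr // mul1r lerDl ltW.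
have := cvx _ _ _ (Px i wi0) (ih W'0) l01.
rewrite scalerA -rmorphM /= scalerDr scalerA -rmorphM /=.
rewrite [w i / _]mulrC (_ : (1 - _) * _ = (w i + W')^-1) //.
by field; rewrite !gt_eqF.
Qed.

(** The chain of the overview for one measurement. Finiteness is recorded to exclude the value [+oo]
    in the final subtraction. *)
Lemma measured_superadditivity (R : realType) n m (M : meas R n)
    (rho sigma : 'M[R[i]]_(n * m)) :
  is_povm M -> psdmx rho -> psdmx sigma -> (rho <= sigma)%MS ->
  (crelent (meas_prob M (ptraceY rho)) (meas_prob M (ptraceY sigma)) +
   qrelent (ptraceX rho) (mixed_condst M rho sigma) <= qrelent rho sigma)%E /\
  (qrelent (ptraceX rho) (mixed_condst M rho sigma) < +oo)%E.
Proof.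
move=> povmM pr ps sub; have dom := submx_dominated ps sub.
have ptr := psd_ptraceX povmM pr.
have sub' : (ptraceX rho <= mixed_condst M rho sigma)%MS.
  exact/dominated_submx/dominated_mixed_condst.
have pq : [forall i, (0 < meas_prob M (ptraceY rho) i) ==>
    (0 < meas_prob M (ptraceY sigma) i)].
  by apply/forallP => i; apply/implyP; exact: meas_prob_dominated.
rewrite /crelent /qrelent sub sub' pq ltry; split=> //.
rewrite -EFinD lee_fin !qrelent_ent //; last exact: psd_mixed_condst.
have h1 := sum_ent_condst_le povmM pr ps dom.
have h2 := ent_mixed_condst_le povmM pr ps dom.
apply: le_trans h1; rewrite addrC -lerBrDr; apply: le_trans h2 _.
under eq_bigr => i _ do rewrite ent_scaled_condst //.
(* [crelent] omits the outcomes with [p i = 0], whose terms are zero. *)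
rewrite sumrB lerB // big_mkcond /=; apply: ler_sum => i _; case: ifP => // /negbT.
rewrite -leNgt => p0.
have -> : meas_prob M (ptraceY rho) i = 0.
  by apply/eqP; rewrite eq_le p0 meas_prob_ptraceY_ge0.
by rewrite mul0r.
Qed.

Theorem theorem1 (R : realType) (n m : nat)
  (PXY : set 'M[R[i]]_(n * m)) (PX : set 'M[R[i]]_n) (PY : set 'M[R[i]]_m)
  (MM : set (meas R n)) :
  convex_states PXY -> convex_states PX -> convex_states PY ->
  (forall M, MM M -> is_povm M) ->
  (* (1) normalized conditional states lie in P *)
  (forall M (i : 'I_(meas_card M)) (s : 'M[R[i]]_(n * m)), MM M -> PXY s ->
     let T := (meas_op M i *t (1%:M : 'M[R[i]]_m)) *m s in
     0 < \tr T -> PY ((\tr T)^-1 *: ptraceX T)) ->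
  (* (2) closure under partial trace *)
  (forall s, PXY s -> PX (ptraceY s)) ->
  (forall s, PXY s -> PY (ptraceX s)) ->
  forall rho : 'M[R[i]]_(n * m), density rho ->
    (MER MM PX (ptraceY rho) + ER PY (ptraceX rho) <= ER PXY rho)%E.
Proof.
move=> cXY _ cY povm cond trY _ rho [pr tr1].
apply: le_ereal_inf_tmp => _ [sigma Psigma <-].
have [ps _] := cXY.1 _ Psigma.
have [sub|nsub] := boolP (rho <= sigma)%MS; last first.
  by rewrite [leRHS]/qrelent (negPf nsub) leey.
have mixedP M : MM M -> PY (mixed_condst M rho sigma).
  move=> MM_M; have povmM := povm _ MM_M; have dom := submx_dominated ps sub.
  (* A convex combination with weights [p i] of states that lie in [PY] whenever [p i > 0]. *)
  have -> : mixed_condst M rho sigma =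
      \sum_i (meas_prob M (ptraceY rho) i)%:C%C *:
        ((\tr (condst sigma i))^-1 *: condst sigma i).
    apply: eq_bigr => i _; rewrite scalerA -meas_prob_ptraceYE //.
    by rewrite -fmorphV -rmorphM.
  apply: convex_states_sum => // [i|i p0|].
  - exact: meas_prob_ptraceY_ge0.
  - rewrite tr_condst; apply: cond => //.
    rewrite -tr_condst -meas_prob_ptraceYE // ltcR.
    exact: meas_prob_dominated p0.
  - under eq_bigr => i _ do rewrite meas_prob_condst.
    rewrite -Re_sum -raddf_sum /= sum_condst //.
    by rewrite -[ptraceX rho]mul1mx tr_mul_ptraceX tens11 mul1mx tr1.
(* [mixed_condst] depends on [M]; replacing it by the infimum over [PY] gives a bound uniform in
   [M], ready for the supremum. *)
have bound M : MM M ->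
    (crelent (meas_prob M (ptraceY rho)) (meas_prob M (ptraceY sigma)) +
     ER PY (ptraceX rho) <= qrelent rho sigma)%E /\ (ER PY (ptraceX rho) < +oo)%E.
  move=> MM_M; have [le1 lt1] := measured_superadditivity (povm _ MM_M) pr ps sub.
  have le2 : (ER PY (ptraceX rho) <=
      qrelent (ptraceX rho) (mixed_condst M rho sigma))%E.
    by apply: ereal_inf_lbound; exists (mixed_condst M rho sigma) => //; exact: mixedP.
  by split; [apply: le_trans le1; exact: leeD2l | exact: le_lt_trans lt1].
have leM : (MER MM PX (ptraceY rho) <=
    measured_relent MM (ptraceY rho) (ptraceY sigma))%E.
  by apply: ereal_inf_lbound; exists (ptraceY sigma) => //; exact: trY.
apply: le_trans (leeD2r _ leM) _.
case E : (ER PY (ptraceX rho)) bound => [r| |] bound.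
- rewrite -leeBrDr //; apply: ge_ereal_sup => _ [M MM_M <-].
  by rewrite leeBrDr //; have [] := bound _ MM_M.
(* Any member of [MM] would make the infimum finite or [-oo], so [MM] is empty, its supremum is
   [-oo], and [-oo + +oo] is [-oo]. *)
- have -> : measured_relent MM (ptraceY rho) (ptraceY sigma) = -oo%E.
    apply/eqP; rewrite -leeNy_eq; apply: ge_ereal_sup => _ [M MM_M <-].
    by have [_] := bound _ MM_M; rewrite ltxx.
  by rewrite leNye.
- by rewrite addeNy leNye.
Qed.
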